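(* Let $F \in K[X,Y,Z,U,V]$ be a Perazzo form of degree $d \ge 5$ (so $V(F)\subset \mathbb{P}^4$ is a Perazzo hypersurface), and let $A_F = R/\operatorname{Ann}_R F$ be the associated Artinian Gorenstein algebra. Then the Hilbert function of $A_F$ is unimodal, i.e. writing $h_i=\dim_K (A_F)_i$ for $0\le i\le d$, there is an index $m$ with $h_0\le h_1\le\cdots\le h_m\ge h_{m+1}\ge\cdots\ge h_d$.
   Context: $K$ is an algebraically closed field of characteristic zero. A Perazzo form of degree $d$ in $K[X,Y,Z,U,V]$ is a homogeneous polynomial of degree $d$ of the form $F = Xp_0+Yp_1+Zp_2+G$ with $p_0,p_1,p_2\in K[U,V]_{d-1}$ linearly independent over $K$ (they are then automatically algebraically dependent) and $G\in K[U,V]_d$. The polynomial ring $R=K[x,y,z,u,v]$ acts on $K[X,Y,Z,U,V]$ by differentiation ($x=\partial/\partial X$, $y=\partial/\partial Y$, $z=\partial/\partial Z$, $u=\partial/\partial U$, $v=\partial/\partial V$); the action is written $p\circ F$. Put $\operatorname{Ann}_R F=\{p\in R \mid p\circ F=0\}$ and $A_F=R/\operatorname{Ann}_R F$, a standard graded Artinian Gorenstein $K$-algebra of socle degree $d$. *)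

(* Defs.v *)
From HB Require Import structures.
From mathcomp Require Import all_boot all_order all_algebra.
From mathcomp Require Import ring_quotient.
From mathcomp Require Import ssrcomplements mpoly.

Set Implicit Arguments.
Unset Strict Implicit.
Unset Printing Implicit Defensive.

Import GRing.Theory.

Local Open Scope ring_scope.
Local Open Scope quotient_scope.

(* The ring of differential operators K[x_1, ..., x_n] and the ring
   K[X_1, ..., X_n] on which it acts are both represented by {mpoly K[n]}. *)
Section Apolarity.
Variables (K : fieldType) (n : nat).
Implicit Types (p q F : {mpoly K[n]}).

(* apolar F p is p o F: F is the first argument, so that apolar F is the linear
   map whose kernel is Ann F. *)
Definition apolar F p : {mpoly K[n]} :=
  \sum_(m <- msupp p) p@_m *: F^`M[m].

Lemma apolarwE k p F : (msize p <= k)%N ->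
  apolar F p = \sum_(m : 'X_{1..n < k}) p@_m *: F^`M[m].
Proof.
move=> le_pk; rewrite /apolar (big_mksub 'X_{1..n < k}) //=.
- rewrite big_rmcond //= => m /memN_msupp_eq0 ->.
  by rewrite scale0r.
- exact: msupp_uniq.
by move=> m /msize_mdeg_lt /leq_trans; apply.
Qed.

Lemma apolar_is_linear F : linear (apolar F).
Proof.
move=> c p q; pose k := maxn (msize (c *: p + q)) (maxn (msize p) (msize q)).
rewrite !(@apolarwE k) ?leq_max ?leqnn ?orbT // scaler_sumr -big_split /=.
by apply: eq_bigr => m _; rewrite mcoeffD mcoeffZ scalerDl scalerA.
Qed.

HB.instance Definition _ F :=
  GRing.isLinear.Build K {mpoly K[n]} {mpoly K[n]} _ (apolar F)
    (apolar_is_linear F).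

Lemma apolarX m F : apolar F 'X_[m] = F^`M[m].
Proof. by rewrite /apolar msuppX big_seq1 mcoeffX eqxx scale1r. Qed.

Lemma apolarU i F : apolar F 'X_i = F^`M(i).
Proof. by rewrite apolarX mderivmU1m. Qed.

Lemma apolar1 F : apolar F 1 = F.
Proof. by rewrite -mpolyX0 apolarX mderivm0m. Qed.

Lemma apolarM p q F : apolar F (p * q) = apolar (apolar F q) p.
Proof.
have aux m : apolar F ('X_[m] * q) = (apolar F q)^`M[m].
  rewrite {1}[q]mpolyE mulr_sumr (linear_sum (apolar F)) /=.
  rewrite [in RHS]/apolar linear_sum /=; apply: eq_bigr => m' _.
  rewrite -scalerAr (linearZ_LR (apolar F)) /= -mpolyXD apolarX addmC.
  by rewrite mderivmDm mderivmZ.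
rewrite {1}[p]mpolyE mulr_suml (linear_sum (apolar F)) /=.
rewrite [RHS]/apolar; apply: eq_bigr => m _.
by rewrite -scalerAl (linearZ_LR (apolar F)) /= aux.
Qed.

(* Ann_R F *)
Definition Ann F : {pred {mpoly K[n]}} := fun p => apolar F p == 0.

Lemma AnnE F p : (p \in Ann F) = (apolar F p == 0).
Proof. by []. Qed.

Fact Ann_zmod_closed F : zmod_closed (Ann F).
Proof.
split=> [|p q]; rewrite !AnnE ?(linear0 (apolar F)) //.
by move=> /eqP p0 /eqP q0; rewrite (linearB (apolar F)) /= p0 q0 subr0.
Qed.

HB.instance Definition _ F :=
  GRing.isZmodClosed.Build {mpoly K[n]} (Ann F) (Ann_zmod_closed F).

Lemma AnnMl F p q : q \in Ann F -> p * q \in Ann F.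
Proof. rewrite !AnnE apolarM => /eqP ->.
by rewrite /apolar big1 // => m _; rewrite linear0 scaler0. Qed.

Lemma Ann_idealr_closed F : F != 0 -> idealr_closed (Ann F).
Proof.
move=> F0; split.
- by rewrite AnnE (linear0 (apolar F)).
- by rewrite AnnE apolar1.
move=> p q r qA rA; have [_ AB] := Ann_zmod_closed F.
by rewrite -[r]opprK; apply: AB; [apply: AnnMl | rewrite rpredN].
Qed.

(* A_F = R / Ann_R F.  Only its structure of K-vector space is declared:
   mathcomp's ring structure on a quotient requires a proper ideal, and Ann F
   is one only when F != 0 (Ann_idealr_closed). *)
Definition A F : Type := {ideal_quot Ann F}.

HB.instance Definition _ F := GRing.Zmodule.on (A F).
HB.instance Definition _ F := EqQuotient.on (A F).

Section LmodA.
Variable F : {mpoly K[n]}.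

Definition piA (p : {mpoly K[n]}) : A F := \pi_(A F) p.

Lemma piA_eq p q : (piA p == piA q) = (p - q \in Ann F).
Proof. by rewrite Quotient.idealrBE. Qed.

Lemma piA_repr (x : A F) : piA (repr x) = x.
Proof. exact: reprK. Qed.

Fact piA_is_zmod_morphism : zmod_morphism piA.
Proof. by move=> p q; rewrite /piA; exact: (raddfB \pi_({ideal_quot Ann F})). Qed.

HB.instance Definition _ :=
  GRing.isZmodMorphism.Build {mpoly K[n]} (A F) piA piA_is_zmod_morphism.

Definition scaleA (c : K) (x : A F) : A F := piA (c *: repr x).

Lemma scaleA_pi c p : scaleA c (piA p) = piA (c *: p).
Proof.
apply/eqP; rewrite piA_eq -scalerBr -mul_mpolyC.
by apply: AnnMl; rewrite -piA_eq piA_repr.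
Qed.

Fact scaleA_A a b x : scaleA a (scaleA b x) = scaleA (a * b) x.
Proof. by rewrite -(piA_repr x) !scaleA_pi scalerA. Qed.

Fact scaleA_1 : left_id 1 scaleA.
Proof. by move=> x; rewrite -(piA_repr x) !scaleA_pi scale1r. Qed.

Fact scaleA_Dr : right_distributive scaleA +%R.
Proof.
move=> a x y; rewrite -(piA_repr x) -(piA_repr y) -raddfD !scaleA_pi.
by rewrite scalerDr raddfD.
Qed.

Fact scaleA_Dl x : {morph scaleA^~ x : a b / a + b}.
Proof.
by move=> a b; rewrite -(piA_repr x) !scaleA_pi scalerDl raddfD.
Qed.

HB.instance Definition _ :=
  GRing.Zmodule_isLmodule.Build K (A F) scaleA_A scaleA_1 scaleA_Dr scaleA_Dl.

Fact piA_is_scalable : scalable piA.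
Proof. by move=> c p; rewrite -scaleA_pi. Qed.

HB.instance Definition _ :=
  GRing.isScalable.Build K {mpoly K[n]} (A F) _ piA piA_is_scalable.

(* A_F is finite-dimensional: p |-> p o F embeds it in the space of
   polynomials whose monomials have degree < msize F. *)
Let N := msize F.
Let W : vectType K := {ffun 'X_{1..n < N} -> K^o}.

Let enc (p : {mpoly K[n]}) : W := [ffun m : 'X_{1..n < N} => p@_m].
Let dec (w : W) : {mpoly K[n]} := \sum_(m : 'X_{1..n < N}) w m *: 'X_[m].

Let enc_linear : linear enc.
Proof. by move=> c p q; apply/ffunP => m; rewrite !ffunE mcoeffD mcoeffZ. Qed.

Let dec_linear : linear dec.
Proof.
move=> c w w'; rewrite /dec scaler_sumr -big_split /=.
by apply: eq_bigr => m _; rewrite !ffunE scalerDl scalerA.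
Qed.

Let f0 (w : W) : W := enc (apolar F (dec w)).

Let f0_linear : linear f0.
Proof.
by move=> c w w'; rewrite /f0 dec_linear (apolar_is_linear F) enc_linear.
Qed.

HB.instance Definition _ := GRing.isLinear.Build K W W _ f0 f0_linear.

Let f := linfun f0.

Lemma mderivm_mdeg_ge m : (N <= mdeg m)%N -> F^`M[m] = 0.
Proof.
move=> le_Nm; apply/mpolyP => m'; rewrite mcoeff_mderivm mcoeff0.
rewrite memN_msupp_eq0 ?mul0rn //; apply/negP => /msize_mdeg_lt.
by rewrite mdegD ltnNge (leq_trans le_Nm (leq_addr _ _)).
Qed.

Let apolar_dec p : apolar F p = apolar F (dec (enc p)).
Proof.
rewrite /dec (linear_sum (apolar F)) /=.
under eq_bigr do rewrite (linearZ_LR (apolar F)) /= apolarX ffunE.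
pose k := maxn N (msize p).
rewrite (@apolarwE k) ?leq_maxr //.
rewrite (bigID (fun m : 'X_{1..n < k} => (mdeg m < N)%N)) /= addrC big1 ?add0r.
  pose wd (m : 'X_{1..n < N}) : 'X_{1..n < k} :=
    BMultinom (leq_trans (bmdeg m) (leq_maxl N (msize p))).
  rewrite (reindex_omap wd (fun m : 'X_{1..n < k} => insub (bmnm m))) /=.
    apply: eq_bigl => m; rewrite bmdeg /=.
    by apply/eqP; exact: (valK m).
  by move=> m mN; rewrite insubT /=; congr Some; apply/val_inj.
by move=> m; rewrite -leqNgt => /mderivm_mdeg_ge ->; rewrite scaler0.
Qed.

Let enc_eq0 p : enc (apolar F p) = 0 -> apolar F p = 0.
Proof.
move=> e0; apply/mpolyP => m; rewrite mcoeff0.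
have [mN|Nm] := ltnP (mdeg m) N.
  by have /ffunP/(_ (BMultinom mN)) := e0; rewrite !ffunE.
rewrite /apolar linear_sum /= big1 // => m' _.
rewrite mcoeffZ mcoeff_mderivm (@memN_msupp_eq0 _ _ F) ?mul0rn ?mulr0 //.
apply/negP => /msize_mdeg_lt.
by rewrite mdegD ltnNge (leq_trans Nm (leq_addl _ _)).
Qed.

Let enc_limg p : enc (apolar F p) \in limg f.
Proof.
rewrite apolar_dec; have -> : enc (apolar F (dec (enc p))) = f (enc p).
  by rewrite /f lfunE.
by rewrite memv_img ?memvf.
Qed.

Let psi (x : A F) : subvs_of (limg f) :=
  vsproj (limg f) (enc (apolar F (repr x))).

Let psi_pi p : psi (piA p) = vsproj (limg f) (enc (apolar F p)).
Proof.
rewrite /psi; congr (vsproj _ (enc _)); apply/eqP.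
by rewrite -subr_eq0 -(linearB (apolar F)) /= -AnnE -piA_eq piA_repr.
Qed.

Let psi_linear : linear psi.
Proof.
move=> c x y; rewrite -(piA_repr x) -(piA_repr y) -linearP !psi_pi.
by rewrite (apolar_is_linear F) enc_linear linearP.
Qed.

Let psi_bij : bijective psi.
Proof.
pose g (y : subvs_of (limg f)) : A F := piA (dec ((f^-1)%VF (vsval y))).
have gK : cancel g psi.
  move=> y; rewrite /g psi_pi.
  have -> : enc (apolar F (dec ((f^-1)%VF (vsval y)))) = f ((f^-1)%VF (vsval y)).
    by rewrite [in RHS]lfunE.
  by rewrite limg_lfunVK ?vsvalK // subvsP.
exists g => // x; have inj : injective psi.
  move=> {}x y; rewrite -(piA_repr x) -(piA_repr y) !psi_pi.
  move=> /(congr1 vsval); rewrite !vsprojK ?enc_limg // => e.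
  apply/eqP; rewrite piA_eq AnnE; apply/eqP/enc_eq0.
  rewrite (linearB (apolar F)) /=.
  by apply/ffunP => m; move/ffunP/(_ m): e; rewrite !ffunE mcoeffB => ->; rewrite subrr.
by apply: inj; rewrite gK.
Qed.

Fact A_vect_axiom : Vector.axiom (\dim (limg f)) (A F).
Proof.
have [v2r v2r_linear v2r_bij] := subvs_vect_iso (limg f).
exists (v2r \o psi) => [c x y|]; first by rewrite /= psi_linear v2r_linear.
exact: bij_comp.
Qed.

HB.instance Definition _ := Lmodule_hasFinDim.Build K (A F) A_vect_axiom.

End LmodA.
End Apolarity.

(* (A_F)_i, as the image of R_i in A_F *)
Definition graded_piece (K : fieldType) (n : nat) (F : {mpoly K[n.+1]})
    (i : nat) : {vspace A F} :=
  limg (linfun (@piA K n.+1 F \o @mpoly_of_dhomog n.+1 K i)).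

Definition hilbert (K : fieldType) (n : nat) (F : {mpoly K[n.+1]})
    (i : nat) : nat :=
  \dim (graded_piece F i).

Lemma graded_pieceP (K : fieldType) (n : nat) (F : {mpoly K[n.+1]}) i (x : A F) :
  reflect (exists2 p : {mpoly K[n.+1]}, p \is i.-homog & x = piA F p)
          (x \in graded_piece F i).
Proof.
apply: (iffP memv_imgP) => [[p _ ->]|[p ph ->]].
  by exists p; [exact: dhomog_is_dhomog | rewrite lfunE].
by exists (DHomog ph); rewrite ?memvf // lfunE.
Qed.

(* The variables X, Y, Z, U, V are those of index 0, 1, 2, 3, 4. *)
Definition XYZ (K : fieldType) (j : 'I_3) : {mpoly K[5]} := 'X_(lshift 2 j).
Definition UV (K : fieldType) (j : 'I_2) : {mpoly K[5]} := 'X_(rshift 3 j).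

Definition inUV (K : fieldType) (p : {mpoly K[2]}) : {mpoly K[5]} :=
  p \mPo [tuple UV K j | j < 2].

Definition is_perazzo (K : fieldType) (d : nat) (F : {mpoly K[5]}) : Prop :=
  exists (p : 3.-tuple (dhomog 2 K d.-1)) (G : dhomog 2 K d),
    free p /\ F = \sum_(j < 3) XYZ K j * inUV (tnth p j) + inUV G.

Definition unimodal (d : nat) (h : nat -> nat) : Prop :=
  exists m : nat, [/\ m <= d,
    forall i, i < m -> h i <= h i.+1 &
    forall i, m <= i < d -> h i.+1 <= h i]%N.

(* Main.v *)
(* F pairs R_i with R_{d-i}.  Since F has degree at most one in X, Y, Z, the
   matrix of this pairing is a block matrix with blocks C = Hankel(G),
   B = Hankel(p_0, p_1, p_2), its analogue B' and 0, whose rank is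
     h_i = rk B + rk B' + rk (the pairing restricted to I_i x I_{d-i}),
   where I is the annihilator of p_0, p_1, p_2 in K[u, v].  The matrix for d - i
   is the transpose, so it suffices to show h_i <= h_{i+1} for i + 1 <= d / 2.
   Let r be the least degree in which I is nonzero and f a form of I_r.
   If i + 1 < r, count dimensions, using that the codimension of I_j does not
   increase once I_j is nonzero.  Otherwise 2r <= d, and I_j = f K[u, v]_{j-r}
   for r <= j <= d - r: for q in I_j, Bezout's identity puts gcd(f, q) in I, so
   that it has degree at least r.  Hence h_j = 2r + rk Hankel(f^2 o G) for these
   j; the rank of the catalecticants of a binary form is nondecreasing up to the
   middle, and h_{r-1} <= 2r by the same count as above. *)

From HB Require Import structures.
Require Import Defs.
From mathcomp Require Import all_boot all_order all_algebra.
From mathcomp Require Import mpoly zify ring.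

Set Implicit Arguments.
Unset Strict Implicit.
Unset Printing Implicit Defensive.

Import GRing.Theory.
Local Open Scope ring_scope.

(** * Ranks of block matrices *)

Section BlockRank.
Variable K : fieldType.

(** The left kernel of [row_mx C B] is the intersection of those of [C] and [B], and the rank of
    [kermx B *m C] is that of [kermx B] minus the dimension of this intersection. *)
Lemma mxrank_row_mx_ker m n1 n2 (C : 'M[K]_(m, n1)) (B : 'M_(m, n2)) :
  \rank (row_mx C B) = (\rank B + \rank (kermx B *m C))%N.
Proof.
have := mxrank_mul_ker (kermx B) C; rewrite mxrank_ker => eC.
have -> : \rank (row_mx C B) = (m - \rank (kermx B :&: kermx C)%MS)%N.
  have := mxrank_ker (row_mx C B).
  have -> : \rank (kermx (row_mx C B)) = \rank (kermx B :&: kermx C)%MS.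
    apply/eqmx_rank/andP; split.
      rewrite sub_capmx; apply/andP; split; apply/sub_kermxP.
        by have /(congr1 rsubmx) := mulmx_ker (row_mx C B);
          rewrite mul_mx_row row_mxKr => ->; apply/matrixP => i j; rewrite !mxE.
      by have /(congr1 lsubmx) := mulmx_ker (row_mx C B);
        rewrite mul_mx_row row_mxKl => ->; apply/matrixP => i j; rewrite !mxE.
    apply/sub_kermxP; rewrite mul_mx_row.
    have /sub_kermxP -> := capmxSl (kermx B) (kermx C).
    have /sub_kermxP -> := capmxSr (kermx B) (kermx C).
    by rewrite row_mx0.
  have := rank_leq_row (row_mx C B); lia.
have := rank_leq_row B; lia.
Qed.

Lemma mxrank_col_mx_ker m1 m2 n (C : 'M[K]_(m1, n)) (B : 'M_(m2, n)) :
  \rank (col_mx C B) = (\rank B + \rank (C *m (kermx B^T)^T))%N.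
Proof.
rewrite -mxrank_tr tr_col_mx mxrank_row_mx_ker mxrank_tr.
by rewrite -[X in (_ + X)%N]mxrank_tr trmx_mul trmxK.
Qed.

(** Splitting first by block columns and then by block rows leaves, as third term, the pairing [C]
    restricted to the left kernels of [B] and [B']. *)
Lemma mxrank_block_mx_dr0 m1 m2 n1 n2 (C : 'M[K]_(m1, n1)) (B : 'M_(m1, n2))
    (B' : 'M_(n1, m2)) :
  \rank (block_mx C B B'^T 0) =
  (\rank B + \rank B' + \rank (kermx B *m C *m (kermx B')^T))%N.
Proof.
rewrite block_mxEh mxrank_row_mx_ker -addnA; congr (_ + _)%N.
  by rewrite -addsmxE addsmx0.
(* The zero block below [B] leaves the last [m2] coordinates of a kernel vector free, hence the
   identity block. *)
pose P : 'M[K]_(m1 + m2) := block_mx (kermx B) 0 0 1%:M.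
have kerE : (kermx (col_mx B (0 : 'M_(m2, n2))) :=: P)%MS.
  apply/eqmxP/andP; split; last first.
    apply/sub_kermxP; rewrite /P mul_block_col mulmx_ker !mul0mx mul1mx !addr0.
    by rewrite col_mx0.
  set Q := kermx _; have QE : Q *m col_mx B 0 = 0 by apply: mulmx_ker.
  rewrite -[Q]hsubmxK mul_row_col mulmx0 addr0 in QE.
  have /submxP[D DE] : (lsubmx Q <= kermx B)%MS by apply/sub_kermxP.
  rewrite -[Q]hsubmxK DE; apply/submxP; exists (row_mx D (rsubmx Q)).
  by rewrite /P mul_row_block !mulmx0 mulmx1 addr0 add0r.
rewrite (eqmxMr _ kerE) mul_block_col !mul0mx mul1mx addr0 add0r.
by rewrite mxrank_col_mx_ker mxrank_tr trmxK.
Qed.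

End BlockRank.

(** * Hankel matrices and annihilators of binary forms *)

Section Hankel.
Variable K : fieldType.
Implicit Types (c : nat -> K) (p q f : {poly K}).

Definition moment c p : K := \sum_(k < size p) p`_k * c k.

Lemma momentwE n c p : (size p <= n)%N -> moment c p = \sum_(k < n) p`_k * c k.
Proof.
move=> le_pn; rewrite /moment (big_ord_widen n (fun k => p`_k * c k) le_pn).
rewrite big_mkcond; apply: eq_bigr => k _; case: ltnP => // le_pk.
by rewrite nth_default // mul0r.
Qed.

Fact moment_is_linear c : scalar (moment c).
Proof.
move=> a p q; pose n := maxn (size (a *: p + q)) (maxn (size p) (size q)).
rewrite !(@momentwE n) ?leq_max ?leqnn ?orbT // mulr_sumr -big_split /=.
by apply: eq_bigr => k _; rewrite coefD coefZ mulrDl mulrA.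
Qed.

HB.instance Definition _ c :=
  GRing.isLinear.Build K {poly K} K _ (moment c) (moment_is_linear c).

Lemma momentXn c k : moment c 'X^k = c k.
Proof.
rewrite /moment size_polyXn big_ord_recr /= coefXn eqxx mul1r big1 ?add0r //.
by move=> i _; rewrite coefXn ltn_eqF ?mul0r.
Qed.

Lemma polywE n p : (size p <= n)%N -> p = \sum_(k < n) p`_k *: 'X^k.
Proof.
move=> le_pn; rewrite -poly_def; apply/polyP => k; rewrite coef_poly.
by case: ltnP => // /(leq_trans le_pn) /(nth_default 0).
Qed.

Definition hankel c k n : 'M[K]_(k, n) := \matrix_(a, b) c (a + b)%N.

Lemma tr_hankel c k n : (hankel c k n)^T = hankel c n k.
Proof. by apply/matrixP => a b; rewrite !mxE addnC. Qed.

Lemma mul_hankel c k n p b : (size p <= k)%N ->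
  (poly_rV p *m hankel c k n) 0 b = moment c (p * 'X^b).
Proof.
move=> le_pk; rewrite mxE [in RHS](polywE le_pk) mulr_suml linear_sum.
apply: eq_bigr => a _ /=.
by rewrite -scalerAl (linearZ_LR (moment c)) /= -exprD momentXn !mxE.
Qed.

(* Forms of degree k in u, v are dehomogenized to polynomials of size at most
   k + 1, and a form of degree e acted upon by K[u, v] is represented by the
   sequence of its values on the monomials u^k v^(e - k).  For such forms phi,
   orth phi (e + 1 - k) p says that p, of degree k, annihilates every phi j. *)
Definition orth m (phi : 'I_m -> nat -> K) n p :=
  forall j q, (size q <= n)%N -> moment (phi j) (p * q) = 0.

Definition multihankel m (phi : 'I_m -> nat -> K) k n : 'M[K]_(k, m * n) :=
  \matrix_(a < k) mxvec (\matrix_(j < m, l < n) phi j (a + l)%N).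

Lemma orthP m (phi : 'I_m -> nat -> K) n p :
  (forall j (b : 'I_n), moment (phi j) (p * 'X^b) = 0) <-> orth phi n p.
Proof.
split=> [h j q le_qn|h j b]; last by apply: h; rewrite size_polyXn.
rewrite (polywE le_qn) mulr_sumr linear_sum big1 // => b _ /=.
by rewrite -scalerAr (linearZ_LR (moment _)) /= h mulr0.
Qed.

Lemma multihankel_kerP m (phi : 'I_m -> nat -> K) k n p : (size p <= k)%N ->
  poly_rV p *m multihankel phi k n = 0 <-> orth phi n p.
Proof.
move=> le_pk; rewrite -orthP.
have E j b : (poly_rV p *m multihankel phi k n) 0 (mxvec_index j b) =
    moment (phi j) (p * 'X^b).
  rewrite -(mul_hankel _ _ le_pk) !mxE; apply: eq_bigr => a _.
  by rewrite !mxE mxvecE mxE.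
split=> [h j b|h]; first by rewrite -E h mxE.
apply/rowP; case/mxvec_indexP => j b.
by rewrite E h mxE.
Qed.

Lemma hankel_kerP c k n p : (size p <= k)%N ->
  poly_rV p *m hankel c k n = 0 <-> orth (fun _ : 'I_1 => c) n p.
Proof.
move=> le_pk; rewrite -orthP; split=> [h j b|h].
  by rewrite -(mul_hankel _ _ le_pk) h mxE.
by apply/rowP => b; rewrite (mul_hankel _ _ le_pk) (h 0) mxE.
Qed.

(* If the kernel of A' were no larger than that of A, the latter would be
   stable under multiplication by 'X, hence contain polynomials of unbounded
   degree. *)
Lemma mxrank_shift k n n' (A : 'M[K]_(k, n)) (A' : 'M_(k.+1, n')) :
    (forall p, (size p <= k)%N -> poly_rV p *m A = 0 ->
       poly_rV p *m A' = 0 /\ poly_rV ('X * p) *m A' = 0) ->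
  ~~ row_free A' -> (\rank A' <= \rank A)%N.
Proof.
(* [E] includes polynomials of size at most [k] among those of size at most [k.+1]; on forms it is
   multiplication by v. *)
move=> shift nfree; pose E : 'M[K]_(k, k.+1) := lin1_mx (poly_rV \o rVpoly).
have mulE (u : 'rV_k) : u *m E = poly_rV (rVpoly u) by rewrite mul_rV_lin1.
have szle (u : 'rV[K]_k) : (size (rVpoly u) <= k)%N by apply: size_poly.
have Einj (u : 'rV_k) : u *m E = 0 -> u = 0.
  rewrite mulE => /(congr1 rVpoly); rewrite poly_rV_K ?linear0; last first.
    exact: leqW.
  by move=> u0; rewrite -(rVpolyK u) u0 linear0.
have kerE : \rank (kermx A *m E) = (k - \rank A)%N.
  rewrite mxrankMfree ?mxrank_ker //; apply/inj_row_free; exact: Einj.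
rewrite -[X in (_ <= X)%N](subKn (rank_leq_row A)) -kerE.
(* Strictness of the inclusion compensates for the extra row of [A']. *)
suff /rank_ltmx : (kermx A *m E < kermx A')%MS by rewrite mxrank_ker; lia.
rewrite ltmxE; apply/andP; split.
  apply/sub_kermxP/row_matrixP => i; rewrite -mulmxA row_mul row0 mulmxA mulE.
  have uA : poly_rV (rVpoly (row i (kermx A))) *m A = 0.
    by rewrite rVpolyK -row_mul mulmx_ker row0.
  by case: (shift _ (szle _) uA).
apply: contra nfree => le_ker.
have stable p : (size p <= k)%N -> poly_rV p *m A = 0 ->
    (size ('X * p)%R <= k)%N /\ poly_rV ('X * p) *m A = 0.
  move=> le_pk pA; have [_ /sub_kermxP XpA'] := shift p le_pk pA.
  have /submxP[w] := submx_trans XpA' le_ker; rewrite mulmxA mulE.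
  have le_Xp : (size ('X * p)%R <= k.+1)%N.
    by rewrite (leq_trans (size_polyMleq _ _)) // size_polyX.
  move=> /(congr1 rVpoly); rewrite !poly_rV_K ?(leqW (szle _)) // => ->.
  by rewrite szle rVpolyK -mulmxA mulmx_ker mulmx0.
have ker0 : kermx A = 0.
  apply/row_matrixP => i; rewrite row0; set u := row i _.
  have stableX l : (size ('X^l * rVpoly u)%R <= k)%N /\
      poly_rV ('X^l * rVpoly u) *m A = 0.
    elim: l => [|l [le_l lA]]; last by rewrite exprS -mulrA; apply: stable.
    by rewrite mul1r szle rVpolyK -row_mul mulmx_ker row0.
  have [u0|u0] := eqVneq (rVpoly u) 0; first by rewrite -(rVpolyK u) u0 linear0.
  have [] := stableX k; rewrite mulrC size_mulXn // => + _.
  by rewrite -size_poly_gt0 in u0; lia.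
by rewrite -kermx_eq0 -submx0 (submx_trans le_ker) // ker0 mul0mx sub0mx.
Qed.

(** Sizes are degrees plus one, so a product of factors of sizes at most [n] and [n'] has size at
    most [(n + n').-1]. *)
Lemma orthM m (phi : 'I_m -> nat -> K) n n' p f : (size f <= n')%N ->
  orth phi (n + n').-1 p -> orth phi n (f * p).
Proof.
move=> le_fn h j q le_qn; rewrite mulrAC mulrC; apply: h.
by rewrite (leq_trans (size_polyMleq _ _)) //; lia.
Qed.

(** The cofactor of [f] is reduced modulo [g] and the quotient is moved to the other cofactor, whose
    size can then be read off from [h - u * f]. *)
Lemma bezout_size (f g h : {poly K}) : coprimep f g -> g != 0 ->
  exists u v : {poly K}, (size u < size g)%N /\ h = u * f + v * g.
Proof.
move=> /Bezout_coprimepP[[u v] /= /eqpf_eq[c c0 uvE]] g0.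
pose u1 := c^-1 *: u * h.
exists (u1 %% g), (c^-1 *: v * h + u1 %/ g * f);
  split; first by rewrite ltn_modp.
have {1}-> : h = c^-1 *: (u * f + v * g) * h.
  by rewrite uvE scalerA mulVf // scale1r mul1r.
have -> : u1 %% g = u1 - u1 %/ g * g by rewrite {2}(divp_eq u1 g) addrC addKr.
by rewrite -/u1; move: (u1 %/ g) => w; rewrite /u1 -!mul_polyC; ring.
Qed.

(* If the gcd of f and q, as forms, had degree r < a, Bezout's identity would
   show that it annihilates phi, against the minimality of a.  As e is only the
   dehomogenized gcd, r also counts the powers of v common to f and q. *)
Lemma orth_dvdp m (phi : 'I_m -> nat -> K) d a b f q :
    f != 0 -> (size f <= a.+1)%N -> (size q <= b.+1)%N ->
    (a <= b)%N -> (a + b <= d)%N ->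
    orth phi (d - a) f -> orth phi (d - b) q ->
    (forall r (e : {poly K}), (r < a)%N -> (size e <= r.+1)%N ->
       orth phi (d - r) e -> e = 0) ->
  exists2 s : {poly K}, (size s <= (b - a).+1)%N & q = f * s.
Proof.
move=> f0 le_f le_q le_ab le_abd fO qO amin.
have [->|q0] := eqVneq q 0; first by exists 0; rewrite ?size_poly0 ?mulr0.
pose e : {poly K} := gcdp f q.
pose f1 : {poly K} := f %/ e; pose q1 : {poly K} := q %/ e.
have e0 : e != 0 by rewrite gcdp_eq0 negb_and f0.
have fE : f = f1 * e by rewrite divpK ?dvdp_gcdl.
have qE : q = q1 * e by rewrite divpK ?dvdp_gcdr.
have f10 : f1 != 0 by apply: contraNneq f0; rewrite fE => ->; rewrite mul0r.
have q10 : q1 != 0 by apply: contraNneq q0; rewrite qE => ->; rewrite mul0r.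
have cop : coprimep f1 q1.
  by rewrite coprimep_div_gcd // f0.
have pf : (0 < size f1)%N by rewrite size_poly_gt0.
have pq : (0 < size q1)%N by rewrite size_poly_gt0.
have pe : (0 < size e)%N by rewrite size_poly_gt0.
have szf : ((size f).+1 = size f1 + size e)%N
  by rewrite fE size_mul // prednK // addn_gt0 pf.
have szq : ((size q).+1 = size q1 + size e)%N
  by rewrite qE size_mul // prednK // addn_gt0 pq.
(* As forms, f and q are divisible by v exactly [a.+1 - size f] and [b.+1 - size q] times; [r] is
   the degree of [e] plus the smaller of these multiplicities. *)
have [r [rf rq rE]] : exists r, [/\ (r + size f <= size e + a)%N,
    (r + size q <= size e + b)%N &
    (r + size f = size e + a)%N \/ (r + size q = size e + b)%N].
  have [le_fq|lt_qf] := leqP (a + size q) (b + size f).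
    by exists (size e + a - size f)%N; split; [| | left]; lia.
  by exists (size e + b - size q)%N; split; [| | right]; lia.
clearbody e f1 q1.
(* If [r] is at least [a], then [f] is itself the gcd up to a scalar, and the quotient is a multiple
   of [q1]. *)
have [lt_ra|ge_ra] := ltnP r a; last first.
  have f1C : size f1 = 1%N by lia.
  have /size_poly1P[c c0 f1E] : size f1 == 1%N by apply/eqP.
  exists (c^-1 *: q1).
    by rewrite (leq_trans (size_scale_leq _ _)) //; lia.
  rewrite qE fE f1E mul_polyC -scalerAl -scalerAr scalerA divff // scale1r.
  by rewrite mulrC.
have le_er : (size e <= r.+1)%N by lia.
suff eO : orth phi (d - r) e by have /eqP := e0; case; apply: (amin r).
move=> j g le_g.
(* Then [e * g = u * f + v * q], with cofactors small enough for [fO] and [qO]. *)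
suff [u [v [le_u le_v gE]]] : exists u v : {poly K},
    [/\ (size u <= d - a)%N, (size v <= d - b)%N & g = u * f1 + v * q1].
  rewrite gE mulrDr linearD /= ![e * _]mulrC -!mulrA -fE -qE ![_ * f]mulrC.
  by rewrite ![_ * q]mulrC fO // qO // addr0.
(* By the choice of [r], either [q1] has full size [(b - r).+1] or [f1] has full size [(a - r).+1].
   One reduces modulo a factor of full size: the size of its product with the remaining cofactor
   then bounds that cofactor well enough, because [a + b <= d]. *)
have [le_q1|lt_q1] := leqP (b - r).+1 (size q1).
  have [u [v [lt_u gE]]] := bezout_size g cop q10.
  exists u, v; split=> //; first by lia.
  have [->|v0] := eqVneq v 0; first by rewrite size_poly0.
  have pv : (0 < size v)%N by rewrite size_poly_gt0.
  have sz_vq : (size (g - u * f1)%R).+1 = (size v + size q1)%N.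
    by rewrite gE addrC addKr size_mul // prednK // addn_gt0 pv.
  have sz_uf : (size (u * f1)%R <= (size u + size f1).-1)%N.
    exact: size_polyMleq.
  have : (size (g - u * f1)%R <= maxn (size g) (size (u * f1)%R))%N.
    by rewrite (leq_trans (size_polyD _ _)) // size_polyN.
  lia.
have cop' : coprimep q1 f1 by rewrite coprimep_sym.
have [v [u [lt_v gE]]] := bezout_size g cop' f10.
exists u, v; split; last by rewrite addrC.
  have [->|u0] := eqVneq u 0; first by rewrite size_poly0.
  have pv : (0 < size u)%N by rewrite size_poly_gt0.
  have sz_vq : (size (g - v * q1)%R).+1 = (size u + size f1)%N.
    by rewrite gE addrC addKr size_mul // prednK // addn_gt0 pv.
  have sz_uf : (size (v * q1)%R <= (size v + size q1).-1)%N.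
    exact: size_polyMleq.
  have : (size (g - v * q1)%R <= maxn (size g) (size (v * q1)%R))%N.
    by rewrite (leq_trans (size_polyD _ _)) // size_polyN.
  lia.
lia.
Qed.
End Hankel.

Section MultihankelKernel.
Variables (K : fieldType) (m : nat).
Implicit Types (phi : 'I_m -> nat -> K) (p : {poly K}).

Lemma orth_leq phi n n' p : (n' <= n)%N -> orth phi n p -> orth phi n' p.
Proof. by move=> le_n h j q le_q; apply: h; apply: leq_trans le_n. Qed.

Lemma multihankel_freeP phi k n :
  reflect (forall p, (size p <= k)%N -> orth phi n p -> p = 0)
          (row_free (multihankel phi k n)).
Proof.
apply: (iffP idP) => [free p le_p /(multihankel_kerP _ _ le_p) pA | h].
  have /(congr1 rVpoly) : poly_rV p = 0 :> 'rV_k.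
    by apply: (row_free_inj free); rewrite mul0mx.
  by rewrite poly_rV_K // linear0.
apply/inj_row_free => u uA; rewrite -(rVpolyK u) (h (rVpoly u)) ?linear0 //.
  exact: size_poly.
by apply/(multihankel_kerP phi n (size_poly _ _)); rewrite rVpolyK.
Qed.

Lemma row_freeNP n1 n2 (A : 'M[K]_(n1, n2)) : ~~ row_free A ->
  exists2 p : {poly K}, p != 0 & (size p <= n1)%N /\ poly_rV p *m A = 0.
Proof.
rewrite -kermx_eq0 => /rowV0Pn[u /sub_kermxP uA u0].
exists (rVpoly u); last by rewrite rVpolyK; split=> //; exact: size_poly.
by apply: contraNneq u0 => p0; rewrite -(rVpolyK u) p0 linear0.
Qed.

Lemma multihankel_row_freeS phi k n :
  row_free (multihankel phi k.+1 n) -> row_free (multihankel phi k n.+1).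
Proof.
move=> /multihankel_freeP h; apply/multihankel_freeP => p le_p pO.
by apply: h; [exact: leqW | exact: orth_leq pO].
Qed.

Lemma orthXM phi n p : orth phi n.+1 p -> orth phi n ('X * p).
Proof.
by move=> pO; apply: (@orthM _ _ _ _ 2); rewrite ?size_polyX // addn2.
Qed.

Lemma size_XM_leq k p : (size p <= k)%N -> (size ('X * p)%R <= k.+1)%N.
Proof.
by move=> le_p; rewrite (leq_trans (size_polyMleq _ _)) // size_polyX.
Qed.

(** The ranks are the codimensions of the annihilator in degrees [k] and [k - 1]; multiplication by
    v and by u carries the latter space into the former. *)
Lemma mxrank_multihankel_shift phi k n :
  ~~ row_free (multihankel phi k.+1 n) ->
  (\rank (multihankel phi k.+1 n) <= \rank (multihankel phi k n.+1))%N.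
Proof.
apply: mxrank_shift => p le_p /(multihankel_kerP phi n.+1 le_p) pO; split.
  by apply/(multihankel_kerP phi n (leqW le_p)); exact: orth_leq pO.
by apply/(multihankel_kerP phi n (size_XM_leq le_p)); exact: orthXM.
Qed.

End MultihankelKernel.

(** * Monotonicity of the rank of the Perazzo pairing up to the middle degree *)

Section PerazzoMatrix.
Variable K : fieldType.
Implicit Types (c : nat -> K) (p q f : {poly K}).

Lemma mxrank_hankel_shift c k n : ~~ row_free (hankel c k.+1 n) ->
  (\rank (hankel c k.+1 n) <= \rank (hankel c k n.+1))%N.
Proof.
apply: mxrank_shift => p le_p /(hankel_kerP c n.+1 le_p) pO; split.
  by apply/(hankel_kerP c n (leqW le_p)); exact: orth_leq pO.
by apply/(hankel_kerP c n (size_XM_leq le_p)); exact: orthXM.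
Qed.

(** If the larger matrix is not of full row rank, a kernel polynomial [p] is, since [k < n], also in
    the kernel of the transposed situation, where the shift goes in the required direction. *)
Lemma mxrank_hankel_mono c k n : (k < n)%N ->
  (\rank (hankel c k n.+1) <= \rank (hankel c k.+1 n))%N.
Proof.
move=> lt_kn; case: (boolP (row_free (hankel c k.+1 n))) => [/eqP -> | ].
  by rewrite (leq_trans (rank_leq_row _)).
move=> /row_freeNP[p p0 [le_p /(hankel_kerP c n le_p) pO]].
have le_p' : (size p <= n.+1)%N by rewrite (leq_trans le_p) // ltnW.
rewrite -[X in (\rank X <= _)%N]tr_hankel -[X in (_ <= \rank X)%N]tr_hankel.
rewrite !mxrank_tr; apply: mxrank_hankel_shift.
apply: contra p0 => free; have /(congr1 rVpoly) : poly_rV p = 0 :> 'rV_n.+1.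
  apply: (row_free_inj free); rewrite mul0mx.
  by apply/(hankel_kerP c k le_p'); apply: orth_leq pO; exact: ltnW.
by rewrite poly_rV_K // linear0 => /eqP.
Qed.

Definition mulpoly_mx f l k : 'M[K]_(l, k) :=
  \matrix_(a < l) poly_rV (f * 'X^a).

Lemma mul_mulpoly_mx f l k (u : 'rV_l) :
  u *m mulpoly_mx f l k = poly_rV (f * rVpoly u).
Proof.
rewrite mulmx_sum_row (polywE (size_poly _ _ : size (rVpoly u) <= l)%N).
rewrite mulr_sumr linear_sum; apply: eq_bigr => a _.
by rewrite rowK coef_rVpoly_ord -scalerAr linearZ.
Qed.

Lemma size_mul_leqS p q n : (size p + size q <= n.+1)%N ->
  (size (p * q)%R <= n)%N.
Proof.
move=> h; apply: leq_trans (size_polyMleq p q) _.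
by rewrite -subn1 leq_subLR add1n.
Qed.

Lemma mulpoly_mx_free f l k : f != 0 -> (size f + l <= k.+1)%N ->
  row_free (mulpoly_mx f l k).
Proof.
move=> f0 le_k; apply/inj_row_free => u; rewrite mul_mulpoly_mx.
have le_u : (size (rVpoly u) <= l)%N := size_poly _ _.
have le_fu : (size (f * rVpoly u)%R <= k)%N.
  by apply: size_mul_leqS; rewrite (leq_trans _ le_k) // leq_add2l.
move=> /(congr1 rVpoly); rewrite poly_rV_K // linear0 => /eqP.
rewrite mulf_eq0 (negPf f0) => /eqP u0.
by rewrite -(rVpolyK u) u0 linear0.
Qed.

(** Pairing [f * g] with [f * h] under [c] is pairing [g] with [h] under the action of [f * f] on
    [c], which the sequence on the right represents. *)
Lemma mulpoly_hankel c f l k l' k' :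
    (size f + l <= k.+1)%N -> (size f + l' <= k'.+1)%N ->
  mulpoly_mx f l k *m hankel c k k' *m (mulpoly_mx f l' k')^T =
  hankel (fun t => moment c (f * f * 'X^t)) l l'.
Proof.
move=> le_k le_k'; apply/matrixP => a b; rewrite [in RHS]mxE.
have le_a : (size (f * 'X^a)%R <= k)%N.
  by apply: size_mul_leqS; rewrite size_polyXn (leq_trans _ le_k) //
    leq_add2l ltn_ord.
have le_b : (size (f * 'X^b)%R <= k')%N.
  by apply: size_mul_leqS; rewrite size_polyXn (leq_trans _ le_k') //
    leq_add2l ltn_ord.
rewrite mxE exprD mulrACA [in RHS](polywE le_b) mulr_sumr linear_sum.
apply: eq_bigr => t _ /=; rewrite -scalerAr (linearZ_LR (moment c)) /=.
rewrite mulrC -(mul_hankel c t le_a); congr (_ * _); first by rewrite !mxE.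
by rewrite -(rowK (fun i : 'I_l => poly_rV (f * 'X^i)) a) -row_mul !mxE.
Qed.


Variables (m : nat) (phi : 'I_m -> nat -> K) (gam : nat -> K).

(* The pairing of R_a with R_b by F, in degrees a + b = d, when phi and gam
   represent the p_j and G. *)
Definition perazzo_mx a b : 'M[K]_(a.+1 + m * a, b.+1 + m * b) :=
  block_mx (hankel gam a.+1 b.+1) (multihankel phi a.+1 b)
           (multihankel phi b.+1 a)^T 0.

Lemma tr_perazzo_mx a b : (perazzo_mx a b)^T = perazzo_mx b a.
Proof. by rewrite tr_block_mx tr_hankel trmxK trmx0. Qed.

(** * The annihilator as the multiples of a generator of least degree *)

Section Generator.
Variables (d r : nat) (f : {poly K}).
Hypotheses (f0 : f != 0) (le_f : (size f <= r.+1)%N) (fO : orth phi (d - r) f).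
Hypothesis rmin : forall (s : nat) (e : {poly K}),
  (s < r)%N -> (size e <= s.+1)%N -> orth phi (d - s) e -> e = 0.

(** One inclusion is [orth_dvdp], applied in degrees [r] and [a], where [r <= b] gives [r + a <= d];
    the other is [orthM]. *)
Lemma kermx_multihankel a b : (a + b = d)%N -> (r <= a)%N -> (r <= b)%N ->
  (kermx (multihankel phi a.+1 b) :=: mulpoly_mx f (a - r).+1 a.+1)%MS.
Proof.
move=> abd le_ra le_rb; have -> : (b = d - a)%N by lia.
apply/eqmxP/andP; split.
  apply/rV_subP => u /sub_kermxP uA; rewrite -(rVpolyK u).
  have le_u : (size (rVpoly u) <= a.+1)%N := size_poly _ _.
  have uO : orth phi (d - a) (rVpoly u).
    by apply/(multihankel_kerP phi (d - a) le_u); rewrite rVpolyK.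
  have le_ra' : (r + a <= d)%N by lia.
  have [s le_s ->] := orth_dvdp f0 le_f le_u le_ra le_ra' fO uO rmin.
  apply/submxP; exists (poly_rV s); rewrite mul_mulpoly_mx poly_rV_K //.
apply/sub_kermxP/row_matrixP => l; rewrite row0 row_mul rowK.
have le_fX : (size ('X^l * f)%R <= a.+1)%N.
  apply: size_mul_leqS; rewrite size_polyXn.
  by rewrite (leq_trans (leq_add (ltn_ord l) le_f)) //; lia.
rewrite mulrC; apply/(multihankel_kerP phi (d - a) le_fX).
apply: (@orthM _ _ _ _ (a - r).+1); first by rewrite size_polyXn ltn_ord.
by apply: orth_leq fO; lia.
Qed.

Lemma mxrank_multihankel_gen a b : (a + b = d)%N -> (r <= a)%N -> (r <= b)%N ->
  \rank (multihankel phi a.+1 b) = r.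
Proof.
move=> abd le_ra le_rb; have := mxrank_ker (multihankel phi a.+1 b).
rewrite (kermx_multihankel abd le_ra le_rb).
have /eqP -> : row_free (mulpoly_mx f (a - r).+1 a.+1).
  apply: mulpoly_mx_free => //.
  by rewrite (leq_trans (leq_add le_f (leqnn _))) //; lia.
have := rank_leq_row (multihankel phi a.+1 b); lia.
Qed.

(** Both kernels in the block formula are spanned by multiples of [f], so the third term is a Hankel
    matrix by [mulpoly_hankel]. *)
Lemma mxrank_perazzo_gen a b : (a + b = d)%N -> (r <= a)%N -> (r <= b)%N ->
  \rank (perazzo_mx a b) = (r + r +
    \rank (hankel (fun t => moment gam (f * f * 'X^t)) (a - r).+1 (b - r).+1))%N.
Proof.
move=> abd le_ra le_rb; have bad : (b + a = d)%N by rewrite addnC.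
have szf i : (r <= i)%N -> (size f + (i - r).+1 <= i.+2)%N.
  by move=> le_rc; rewrite (leq_trans (leq_add le_f (leqnn _))) //; lia.
rewrite /perazzo_mx mxrank_block_mx_dr0 !mxrank_multihankel_gen //.
congr (_ + _)%N; rewrite -(mulpoly_hankel gam (szf _ le_ra) (szf _ le_rb)).
rewrite -(mulmxA (kermx _)) (eqmxMr _ (kermx_multihankel abd le_ra le_rb)).
rewrite mulmxA.
rewrite -mxrank_tr -[in RHS]mxrank_tr !trmx_mul !trmxK.
by rewrite (eqmxMr _ (kermx_multihankel bad le_rb le_ra)).
Qed.

End Generator.

Lemma mxrank_perazzo_mono a b : (a < b)%N ->
  (\rank (perazzo_mx a b.+1) <= \rank (perazzo_mx a.+1 b))%N.
Proof.
move=> lt_ab; pose d := (a + b.+1)%N.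
have free0 n : row_free (multihankel phi a.+1 n) -> forall n1 n2
    (C : 'M[K]_(a.+1, n1)) (D : 'M_(n1, n2)),
    \rank (kermx (multihankel phi a.+1 n) *m C *m D) = 0%N.
  by rewrite -kermx_eq0 => /eqP -> *; rewrite !mul0mx mxrank0.
have [free|nfree] := boolP (row_free (multihankel phi a.+2 b)).
  have free' := multihankel_row_freeS free.
  rewrite !mxrank_block_mx_dr0 free0 // (eqP free) (eqP free').
  (* The first block gains one in rank, from [a.+1] to [a.+2], so the other may lose one. *)
  suff : (\rank (multihankel phi b.+2 a) <=
          (\rank (multihankel phi b.+1 a.+1)).+1)%N by lia.
  have [free2|/mxrank_multihankel_shift/leqW //] :=
    boolP (row_free (multihankel phi b.+2 a)).
  by rewrite (eqP free2) (eqP (multihankel_row_freeS free2)).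
(* From here on the annihilator is nonzero in degree [a.+1], so its least degree [r] is at most
   [a.+1]. *)
have exr : exists r, ~~ row_free (multihankel phi r.+1 (d - r)).
  exists a.+1; have -> // : (d - a.+1 = b)%N by rewrite /d; lia.
have [r nfree_r rmin0] := ex_minnP exr.
have [f f0 [le_f /(multihankel_kerP phi _ le_f) fO]] := row_freeNP nfree_r.
have rmin s (e : {poly K}) : (s < r)%N -> (size e <= s.+1)%N ->
    orth phi (d - s) e -> e = 0.
  move=> lt_sr; have : row_free (multihankel phi s.+1 (d - s)).
    by apply: contraLR lt_sr => /rmin0; rewrite -leqNgt.
  by move=> /multihankel_freeP; apply.
have le_ra : (r <= a.+1)%N.
  by apply: rmin0; have -> // : (d - a.+1 = b)%N by rewrite /d; lia.
have rk := mxrank_perazzo_gen f0 le_f fO rmin.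
have abd : (a.+1 + b = d)%N by rewrite /d addSnnS.
have le_rb : (r <= b)%N := leq_trans le_ra lt_ab.
rewrite (rk a.+1 b) //.
have [le_ra'|lt_ar] := leqP r a.
  rewrite (rk a b.+1) ?leqW // leq_add2l !subSn //.
  apply: mxrank_hankel_mono.
  by rewrite ltnS ltn_sub2r // (leq_ltn_trans le_ra').
(* In degree [a] the annihilator is zero, so the restricted pairing contributes nothing, and each of
   the two remaining ranks is at most [r], the second by the shift. *)
have rE : r = a.+1 by lia.
rewrite mxrank_block_mx_dr0 free0; last first.
  apply/multihankel_freeP => p le_p pO; apply: (rmin a) => //.
  by apply: orth_leq pO; rewrite /d; lia.
rewrite addn0 (leq_trans _ (leq_addr _ _)) // leq_add //.
  by rewrite (leq_trans (rank_leq_row _)).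
have bad : (b + a.+1 = d)%N by rewrite addnC.
rewrite -[X in (_ <= X)%N](mxrank_multihankel_gen f0 le_f fO rmin bad) //.
apply: mxrank_multihankel_shift; apply/multihankel_freeP => h.
have /eqP := f0; case; apply: h.
  by rewrite (leq_trans le_f) // rE ltnS (leq_trans lt_ab).
by apply: orth_leq fO; rewrite /d; lia.
Qed.
End PerazzoMatrix.

(** * The Hilbert function as a rank *)

(** The rows of [P] are preimages of a row basis of [M]; on their span [g] is injective and keeps
    its whole image. *)
Lemma dim_limg_mxrank (K : fieldType) (V : vectType K) n1 n2
    (g : 'Hom('rV[K]_n1, V)) (M : 'M_(n1, n2)) :
  (forall w, g w = 0 <-> w *m M = 0) -> \dim (limg g) = \rank M.
Proof.
move=> kerE; have /submxP[P PE] : (row_base M <= M)%MS by rewrite eq_row_base.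
pose g' (s : 'rV[K]_(\rank M)) : V := g (s *m P).
have g'_lin : linear g' by move=> c s t; rewrite /g' mulmxDl -scalemxAl linearP.
pose G : {linear _ -> _} := HB.pack g' (GRing.isLinear.Build _ _ _ _ g' g'_lin).
have -> : limg g = limg (linfun G).
  apply/vspaceP => x; apply/memv_imgP/memv_imgP => -[w _ ->]; last first.
    by exists (w *m P); rewrite ?memvf // lfunE.
  have /submxP[s sE] : (w *m M <= row_base M)%MS by rewrite eq_row_base submxMl.
  exists s; rewrite ?memvf // lfunE /= /g'; apply/eqP.
  rewrite -subr_eq0 -linearB; apply/eqP/kerE.
  by rewrite mulmxBl -mulmxA -PE sE subrr.
suff -> : \dim (limg (linfun G)) = \dim {:'rV[K]_(\rank M)}.
  by rewrite dimvf dim_matrix mul1r.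
apply: limg_dim_eq; apply/eqP; rewrite -subv0; apply/subvP => s.
rewrite memv_cap memv_ker lfunE memv0 => /andP[_ /eqP/kerE].
by rewrite -mulmxA -PE => /eqP; rewrite mulmx_free_eq0 ?row_base_free.
Qed.

Lemma piA_eq0 (K : fieldType) n (F p : {mpoly K[n]}) :
  piA F p = 0 <-> apolar F p = 0.
Proof.
have E : (piA F p == 0) = (apolar F p == 0).
  by rewrite -[X in _ == X](linear0 (piA F)) piA_eq subr0 AnnE.
by split=> /eqP; [rewrite E | rewrite -E] => /eqP.
Qed.

(** * Monomials and their degree in x, y, z *)

Section Monomials.

Definition xyz (j : 'I_3) : 'X_{1..3 + 2} := U_(lshift 2 j)%MM.
Definition uv (k l : nat) : 'X_{1..3 + 2} :=
  (U_(rshift 3 ord0) *+ k + U_(rshift 3 ord_max) *+ l)%MM.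
Definition xdeg (mm : 'X_{1..3 + 2}) : nat := \sum_(j < 3) mm (lshift 2 j).

Lemma xdegD m1 m2 : xdeg (m1 + m2)%MM = (xdeg m1 + xdeg m2)%N.
Proof. by rewrite /xdeg -big_split; apply: eq_bigr => j _; rewrite mnmDE. Qed.

Lemma xdeg_uv k l : xdeg (uv k l) = 0%N.
Proof.
rewrite /xdeg big1 // => j _; rewrite mnmDE !mulmnE !mnm1E.
by rewrite !eq_rlshift.
Qed.

Lemma xdeg_xyz j : xdeg (xyz j) = 1%N.
Proof.
rewrite /xdeg (bigD1 j) //= mnm1E eqxx big1 // => i ne_ij.
by rewrite mnm1E (inj_eq (@lshift_inj _ _)) eq_sym (negPf ne_ij).
Qed.

Lemma mdeg_uv k l : mdeg (uv k l) = (k + l)%N.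
Proof. by rewrite mdegD !mdegMn !mdeg1 !mul1n. Qed.

Lemma mdeg_xyz j : mdeg (xyz j) = 1%N.
Proof. exact: mdeg1. Qed.

Lemma uvD k l k' l' : (uv k l + uv k' l')%MM = uv (k + k') (l + l').
Proof. by apply/mnmP => i; rewrite !(mnmDE, mulmnE); lia. Qed.

Lemma xdeg0P mm : xdeg mm = 0%N ->
  mm = uv (mm (rshift 3 ord0)) (mm (rshift 3 ord_max)).
Proof.
move=> x0; apply/mnmP => i; rewrite -(splitK i); case: (split i) => j /=.
  rewrite !(mnmDE, mulmnE, mnm1E) !eq_rlshift.
  by move/eqP: x0; rewrite /xdeg sum_nat_eq0 => /forallP/(_ j)/eqP.
rewrite !(mnmDE, mulmnE, mnm1E) !(inj_eq (@rshift_inj _ _)).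
case: j => -[|[|//]] p /=; rewrite mul1n mul0n ?addn0 ?add0n;
  by congr (mm _); exact: val_inj.
Qed.

Lemma xdeg1P mm : xdeg mm = 1%N ->
  exists j k l, mm = (xyz j + uv k l)%MM.
Proof.
move=> x1; case: (pickP (fun j : 'I_3 => (0 < mm (lshift 2 j))%N)) => [j mj|m0];
  last first.
  move: x1; rewrite /xdeg big1 // => j _.
  by have /negbT := m0 j; rewrite lt0n negbK => /eqP.
have mE : mm = (xyz j + (mm - xyz j))%MM.
  rewrite addmC submK //; apply/mnm_lepP => i.
  by rewrite mnm1E; case: eqP => // <-.
have := xdegD (xyz j) (mm - xyz j)%MM; rewrite -mE x1 xdeg_xyz => -[] /esym.
move=> /xdeg0P mE'; exists j; rewrite {1}mE mE'; eauto.
Qed.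

End Monomials.

(** * From the action on F to the pairing matrix *)

Section Bridge.
Variables (K : fieldType) (d : nat) (F : {mpoly K[3 + 2]}).
Hypothesis charK0 : [pchar K] =i pred0.
Hypothesis F_supp : forall mm, F@_mm != 0 -> mdeg mm = d /\ (xdeg mm <= 1)%N.

(** This is the coefficient of F times the factorials of the exponents. The rescaling turns
    differentiation into a shift of exponents, so that the matrices are Hankel without binomial
    factors. *)
Definition dual_coef mm : K := (F^`M[mm])@_0.

Lemma dual_coef_supp mm : dual_coef mm != 0 -> mdeg mm = d /\ (xdeg mm <= 1)%N.
Proof.
rewrite /dual_coef mcoeff_mderivm addm0 => ne; apply: F_supp.
apply: contraNneq ne => ->.
by rewrite mul0rn.
Qed.

(** Characteristic zero enters here: the product of factorials is invertible. *)
Lemma mderivm_mcoeff_eq0 (p : {mpoly K[3 + 2]}) mm :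
  (p^`M[mm])@_0 = 0 -> p@_mm = 0.
Proof.
rewrite mcoeff_mderivm addm0 => /eqP; rewrite -mulr_natr mulf_eq0.
move=> /orP[/eqP //|].
have /pcharf0P -> := charK0; rewrite -leqn0 leqNgt prodn_gt0 // => j.
by rewrite ffact_gt0.
Qed.

Definition unmxvec m n (c : 'I_(m * n)) : 'I_m * 'I_n :=
  enum_val (cast_ord (esym (mxvec_cast m n)) c).

Lemma mxvec_indexK m n (j : 'I_m) (k : 'I_n) :
  unmxvec (mxvec_index j k) = (j, k).
Proof. by rewrite /unmxvec /mxvec_index cast_ordK enum_rankK. Qed.

(* The monomials of degree a and of degree at most one in x, y, z, in the order
   of the rows of perazzo_mx. *)
Definition rowmon a (c : 'I_(a.+1 + 3 * a)) : 'X_{1..3 + 2} :=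
  match split c with
  | inl k => uv k (a - k)
  | inr c' =>
      (xyz (unmxvec c').1 + uv (unmxvec c').2 (a.-1 - (unmxvec c').2))%MM
  end.

Lemma rowmonl a (k : 'I_a.+1) : rowmon (lshift _ k) = uv k (a - k).
Proof. by rewrite /rowmon (unsplitK (inl k)). Qed.

Lemma rowmonr a j (k : 'I_a) :
  rowmon (rshift _ (mxvec_index j k)) = (xyz j + uv k (a.-1 - k))%MM.
Proof. by rewrite /rowmon (unsplitK (inr _)) mxvec_indexK. Qed.

Lemma mdeg_rowmon a (c : 'I_(a.+1 + 3 * a)) : mdeg (rowmon c) = a.
Proof.
rewrite -(splitK c); case: (split c) => [k|c'] /=.
  by rewrite rowmonl mdeg_uv subnKC // -ltnS.
case/mxvec_indexP: c' => j k; rewrite rowmonr mdegD mdeg_uv mdeg_xyz.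
by have := ltn_ord k; lia.
Qed.

Lemma rowmonP a mm : mdeg mm = a -> (xdeg mm <= 1)%N ->
  exists c : 'I_(a.+1 + 3 * a), mm = rowmon c.
Proof.
move=> mda; rewrite leq_eqVlt ltnS leqn0 => /orP[/eqP/xdeg1P | /eqP/xdeg0P].
  move=> [j [k [l mE]]]; rewrite mE mdegD mdeg_uv mdeg_xyz in mda.
  have lt_k : (k < a)%N by lia.
  exists (rshift _ (mxvec_index j (Ordinal lt_k))); rewrite rowmonr mE /=.
  by congr (_ + uv _ _)%MM; lia.
set k := mm _; set l := mm _ => mE; rewrite mE mdeg_uv in mda.
have lt_k : (k < a.+1)%N by lia.
by exists (lshift _ (Ordinal lt_k)); rewrite rowmonl mE /=; congr uv; lia.
Qed.

(** For a Perazzo form, differentiating by x, y, z gives the p_j, of degree [d.-1], which [phiF]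
    represents; [gamF] represents G. *)
Definition phiF (j : 'I_3) (k : nat) : K :=
  dual_coef (xyz j + uv k (d.-1 - k))%MM.
Definition gamF (k : nat) : K := dual_coef (uv k (d - k)).

Lemma perazzo_mxE a b (r : 'I_(a.+1 + 3 * a)) (c : 'I_(b.+1 + 3 * b)) :
  (a + b = d)%N ->
  perazzo_mx phiF gamF a b r c = dual_coef (rowmon r + rowmon c)%MM.
Proof.
move=> abd; rewrite -(splitK r) -(splitK c).
case: (split r) => [k|r']; case: (split c) => [l|c'] /=.
- rewrite block_mxEul mxE !rowmonl uvD /gamF; congr (dual_coef (uv _ _)).
  by have := ltn_ord k; have := ltn_ord l; lia.
- case/mxvec_indexP: c' => j l; rewrite block_mxEur mxE mxvecE mxE.
  rewrite rowmonl rowmonr.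
  rewrite addmC -addmA uvD /phiF (addnC k); congr (dual_coef (_ + uv _ _)%MM).
  by have := ltn_ord k; have := ltn_ord l; lia.
- case/mxvec_indexP: r' => j k; rewrite block_mxEdl mxE mxE mxvecE.
  rewrite mxE rowmonl rowmonr.
  rewrite -addmA uvD /phiF (addnC k); congr (dual_coef (_ + uv _ _)%MM).
  by have := ltn_ord k; have := ltn_ord l; lia.
case/mxvec_indexP: r' => j k; case/mxvec_indexP: c' => j' l.
(* The product of two such monomials has degree two in x, y, z, beyond the support of F. *)
rewrite block_mxEdr mxE !rowmonr; apply/esym/eqP; apply: contraT.
move=> /dual_coef_supp[_].
by rewrite !xdegD !xdeg_xyz; lia.
Qed.

Section Row.
Variables (a b : nat) (abd : (a + b = d)%N).

Definition rowpoly (w : 'rV[K]_(a.+1 + 3 * a)) : {mpoly K[3 + 2]} :=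
  \sum_c w 0 c *: 'X_[rowmon c].

Lemma rowpoly_is_linear : linear rowpoly.
Proof.
move=> x w w'; rewrite /rowpoly scaler_sumr -big_split /=.
by apply: eq_bigr => c _; rewrite !mxE scalerDl scalerA.
Qed.

HB.instance Definition _ := GRing.isLinear.Build _ _ _ _ rowpoly
  rowpoly_is_linear.

Lemma apolar_rowpoly w mm :
  ((apolar F (rowpoly w))^`M[mm])@_0 = \sum_c w 0 c * dual_coef (rowmon c + mm)%MM.
Proof.
rewrite /rowpoly (linear_sum (apolar F)) !linear_sum; apply: eq_bigr => c _ /=.
by rewrite (linearZ_LR (apolar F)) /= mderivmZ mcoeffZ apolarX -mderivmDm.
Qed.

Lemma apolar_rowpoly_eq0 w :
  apolar F (rowpoly w) = 0 <-> w *m perazzo_mx phiF gamF a b = 0.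
Proof.
have E c : (w *m perazzo_mx phiF gamF a b) 0 c =
    ((apolar F (rowpoly w))^`M[rowmon c])@_0.
  by rewrite mxE apolar_rowpoly; apply: eq_bigr => r _; rewrite perazzo_mxE.
split=> [w0|w0]; first by apply/rowP => c; rewrite E w0 linear0 mcoeff0 mxE.
apply/mpolyP => mm; rewrite mcoeff0; apply: mderivm_mcoeff_eq0.
have [/andP[/eqP mdb x1]|out] := boolP ((mdeg mm == b) && (xdeg mm <= 1)%N).
  by have [c ->] := rowmonP mdb x1; rewrite -E w0 mxE.
(* For any other [mm], each [rowmon r + mm] has the wrong degree or is at least quadratic in x, y,
   z. *)
rewrite apolar_rowpoly big1 // => r _; apply/eqP.
rewrite mulf_eq0; apply/orP; right.
apply: contraNT out => /dual_coef_supp[]; rewrite mdegD mdeg_rowmon xdegD; lia.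
Qed.

(** Monomials of degree two or more in x, y, z annihilate F, so the image of [rowpoly] fills the
    graded piece, and the kernel is that of the matrix. *)
Lemma hilbert_mxrank : hilbert F a = \rank (perazzo_mx phiF gamF a b).
Proof.
pose g w : A F := piA F (rowpoly w).
have g_lin : linear g by move=> x w w'; rewrite /g !linearP.
pose G : {linear _ -> _} := HB.pack g (GRing.isLinear.Build _ _ _ _ g g_lin).
rewrite -(@dim_limg_mxrank _ _ _ _ (linfun G)); last first.
  move=> w; rewrite lfunE /= /g -apolar_rowpoly_eq0.
  exact: piA_eq0.
congr (\dim _); apply/vspaceP => x; apply/graded_pieceP/memv_imgP; last first.
  move=> [w _ ->]; exists (rowpoly w); last by rewrite lfunE.
  apply: rpred_sum => c _; apply: rpredZ.
  by rewrite dhomogX; apply/eqP; exact: mdeg_rowmon.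
move=> [p p_homog ->]; rewrite [p]mpolyE linear_sum.
suff : \sum_(i <- msupp p) piA F (p@_i *: 'X_[i]) \in limg (linfun G).
  by move/memv_imgP.
rewrite big_seq; apply: rpred_sum => mm mm_p; rewrite linearZ rpredZ //.
have mda : mdeg mm = a by apply/eqP; move/dhomogP: p_homog => /(_ _ mm_p) /eqP.
have [x1|x2] := leqP (xdeg mm) 1.
  have [c ->] := rowmonP mda x1.
  apply/memv_imgP; exists (delta_mx 0 c); rewrite ?memvf //.
  rewrite lfunE /= /g /rowpoly.
  rewrite (bigD1 c) //= mxE !eqxx scale1r big1 ?addr0 // => c' ne_c.
  by rewrite mxE (negPf ne_c) andbF scale0r.
suff e0 : piA F 'X_[mm] = 0 by rewrite /= e0 rpred0.
apply/piA_eq0; rewrite apolarX; apply/mpolyP => n.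
rewrite mcoeff0 mcoeff_mderivm.
suff -> : F@_(mm + n) = 0 by rewrite mul0rn.
apply/eqP; apply: contraT => /F_supp[_]; rewrite xdegD; lia.
Qed.

End Row.
End Bridge.

(** * Support of a Perazzo form and unimodality *)

Lemma perazzo_supp (K : fieldType) d (F : {mpoly K[5]}) : (0 < d)%N ->
  is_perazzo d F -> forall mm, F@_mm != 0 -> mdeg mm = d /\ (xdeg mm <= 1)%N.
Proof.
move=> d_gt0 [p [G [_ ->]]].
pose supp_in (q : {mpoly K[5]}) :=
  forall mm, q@_mm != 0 -> mdeg mm = d /\ (xdeg mm <= 1)%N.
have supp_sum (I : eqType) (r : seq I) (E : I -> {mpoly K[5]}) :
    (forall i, i \in r -> supp_in (E i)) -> supp_in (\sum_(i <- r) E i).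
  move=> h mm; rewrite linear_sum /= => ne0.
  have [/hasP[i ir ne_i]|/hasPn h0] := boolP (has (fun i => (E i)@_mm != 0) r).
    exact: h ne_i.
  by case/eqP: ne0; rewrite big_seq big1 // => i /h0; rewrite negbK => /eqP.
have suppX c (mm : 'X_{1..3 + 2}) : mdeg mm = d -> (xdeg mm <= 1)%N ->
    supp_in (c *: 'X_[mm]).
  move=> md x1 m'; rewrite mcoeffZ mcoeffX; case: (mm =P m') => [<- //|_].
  by rewrite mulr0 eqxx.
(* Substituting variables for variables only renames exponents. *)
have inUVE (q : {mpoly K[2]}) :
    inUV q = \sum_(n <- msupp q) q@_n *: 'X_[uv (n ord0) (n ord_max)].
  rewrite /inUV comp_mpolyE; apply: eq_bigr => n _; congr (_ *: _).
  rewrite big_ord_recl big_ord1 !tnth_mktuple /UV !mpolyXn -mpolyXD.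
  congr ('X_[ _ + U_(rshift 3 _) *+ n _]); exact: val_inj.
have mdegE2 (e : nat) (q : dhomog 2 K e) (n : 'X_{1..2}) :
    n \in msupp (q : {mpoly K[2]}) -> (n ord0 + n ord_max = e)%N.
  have /dhomogP h := dhomog_is_dhomog q => nq; have <- : mdeg n = e := h n nq.
  by rewrite mdegE big_ord_recl big_ord1; congr (_ + n _)%N; exact: val_inj.
move=> mm; rewrite mcoeffD.
have [->|ne0 _] := eqVneq (\sum_(j < 3) XYZ K j * inUV (tnth p j))@_mm 0.
  rewrite add0r inUVE; apply: supp_sum => n nG; apply: suppX.
    by rewrite mdeg_uv (mdegE2 _ _ _ nG).
  by rewrite xdeg_uv.
move: ne0; apply: (supp_sum _ _ _) => j _; rewrite inUVE mulr_sumr.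
apply: supp_sum => n np; rewrite -scalerAr /XYZ -mpolyXD; apply: suppX.
  by rewrite mdegD mdeg1 mdeg_uv (mdegE2 _ _ _ np); lia.
by rewrite xdegD xdeg_xyz xdeg_uv.
Qed.

Theorem theorem3p6 (K : closedFieldType) (charK0 : [pchar K] =i pred0)
    (d : nat) (d_ge5 : (5 <= d)%N) (F : {mpoly K[5]})
    (perazzoF : is_perazzo d F) :
  unimodal d (hilbert F).
Proof.
have d_gt0 : (0 < d)%N := leq_trans (isT : (0 < 5)%N) d_ge5.
have F_supp := perazzo_supp d_gt0 perazzoF.
have hE a b (abd : (a + b = d)%N) := hilbert_mxrank charK0 F_supp abd.
have mono a b : (a + b.+1 = d)%N -> (a < b)%N ->
    (hilbert F a <= hilbert F a.+1)%N.
  move=> abd lt_ab; rewrite (hE _ _ abd) (hE a.+1 b) ?addSnnS //.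
  exact: mxrank_perazzo_mono.
have sym a b : (a + b = d)%N -> hilbert F a = hilbert F b.
  move=> abd; rewrite (hE _ _ abd) (hE b a) 1?addnC //.
  by rewrite -mxrank_tr tr_perazzo_mx.
exists d./2; split=> [|i lt_i|i /andP[le_i lt_i]].
- by have := odd_double_half d; lia.
- by apply: (mono i (d - i.+1)%N); have := odd_double_half d; lia.
(* The second case forces [d = 2i + 1], where the two middle values agree by symmetry; in the first,
   symmetry reflects the step below the middle. *)
have [lt_di|le_id] := ltnP (d - i.+1) i; last first.
  by rewrite (sym i i.+1) //; have := odd_double_half d; lia.
rewrite (sym i (d - i.+1).+1) 1?(sym i.+1 (d - i.+1)%N) ?subnKC //; try lia.
by apply: (mono _ i) => //; lia.
Qed.
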